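(* Let $f:[0,1]\to[0,1]$ be continuous and monotonically increasing with $f(0)=0$. There is a monotone function $g:\mathbb N\to\mathbb N$ such that the class $\mathcal C_g$ satisfies: (i) $\mathcal C_g$ is realizably learnable with sample complexity $m^{\mathrm{re}}_{\mathcal C_g}(\epsilon,\delta)\le\log(1/\delta)\,g(1/\epsilon)$; (ii) $\mathcal C_g$ is not adaptively additively $f$-robustly learnable; moreover there is an adaptive additive adversary $V_{\mathrm{add}}$ that is a universal $f$-adversary for $\mathcal C_g$; (iii) $\mathcal C_g$ is not adaptively subtractively $f$-robustly learnable; moreover there is an adaptive subtractive adversary $V_{\mathrm{sub}}$ that is a universal $f$-adversary for $\mathcal C_g$.
   Context: Let $\{B_i\}_{i\in\mathbb N}$ enumerate the finite subsets of $\mathbb N$; $p_{i,j,k}=(1-\frac1j)\delta_{(0,0)}+(\frac1j-\frac1k)U_{B_i\times\{2j+1\}}+\frac1k\delta_{(i,2j+2)}$ on $\mathbb N\times\mathbb N$; $\mathcal C_g=\{p_{i,j,g(j)}:i,j\in\mathbb N\}$. Realizable learnability: a learner $A$ with $m^{\mathrm{re}}(\epsilon,\delta)$ such that for all $p\in\mathcal C$, $m\ge m^{\mathrm{re}}(\epsilon,\delta)$, with probability $\ge1-\delta$ over $S\sim p^m$, $d_{\mathrm{TV}}(A(S),p)\le\epsilon$. Samples are multisets; an adaptive adversary is a randomized map $V$ from finite multisets to finite multisets, additive if $S\subset V(S)$, subtractive if $V(S)\subset S$, with fixed constant budget $\eta=\mathrm{budget}(V)$: $|V(S)|$ depends only on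 $|S|$ and $\eta m-1<\sup_{|S|=m}\big||V(S)|-|S|\big|\le\eta m$. $\mathcal C$ is adaptively additively (resp. subtractively) $f$-robustly learnable if there are a learner $A$ and $m(\epsilon,\delta)$ such that for all $p\in\mathcal C$, all adaptive additive (resp. subtractive) adversaries $V$, $\epsilon,\delta\in(0,1)$, $m\ge m(\epsilon,\delta)$, with probability $\ge1-\delta$ over $S\sim p^m$, $d_{\mathrm{TV}}(A(V(S)),p)\le f(\mathrm{budget}(V))+\epsilon$. $V$ is a universal $f$-adversary for $\mathcal C$ if no learner achieves this guarantee against $V$ alone. *)

(* Defs.v *)
From HB Require Import structures.
From mathcomp Require Import all_boot all_order all_algebra.
From mathcomp Require Import all_classical all_reals all_analysis.
Set Implicit Arguments. Unset Strict Implicit. Unset Printing Implicit Defensive.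
Import Order.TTheory GRing.Theory Num.Theory.
Import numFieldNormedType.Exports.
Local Open Scope classical_set_scope.
Local Open Scope ring_scope.

Definition X := (nat * nat)%type.

Section Defs.
Variable R : realType.

Definition is_dist (T : choiceType) (q : T -> R) : Prop :=
  (forall x, 0 <= q x) /\ (\esum_(x in [set: T]) (q x)%:E = 1)%E.

Definition dTV (p q : X -> R) : R :=
  fine (\esum_(x in [set: X]) (`|p x - q x|)%:E) / 2.

(* Samples are multisets; a multiset is represented canonically by the sorted
   sequence of its elements (lexicographic order on N x N). *)
Definition lexle (a b : X) : bool := (a.1 < b.1)%N || ((a.1 == b.1) && (a.2 <= b.2)%N).
Definition msort (s : seq X) : seq X := sort lexle s.

Definition msub (s t : seq X) : Prop := forall x, (count_mem x s <= count_mem x t)%N.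

Definition prodp (p : X -> R) (s : seq X) : R := \prod_(x <- s) p x.

Definition learner (A : seq X -> X -> R) : Prop := forall S, is_dist (A S).

(* A randomized adversary: V S is a distribution over (representatives of)
   multisets. *)
Definition adversary (V : seq X -> seq X -> R) : Prop := forall S, is_dist (V S).

Definition additive_adv (V : seq X -> seq X -> R) : Prop :=
  adversary V /\ forall S T, 0 < V S T -> msub S T.
Definition subtractive_adv (V : seq X -> seq X -> R) : Prop :=
  adversary V /\ forall S T, 0 < V S T -> msub T S.

(* budget(V) = eta: |V(S)| depends only on |S| (through n), and
   eta m - 1 < sup_{|S|=m} ||V(S)| - |S|| <= eta m for every m. *)
Definition has_budget (V : seq X -> seq X -> R) (eta : R) : Prop :=
  exists n : nat -> nat,
    (forall S T, 0 < V S T -> size T = n (size S)) /\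
    (forall m : nat, eta * m%:R - 1 < `|(n m)%:R - m%:R| /\
                     `|(n m)%:R - m%:R| <= eta * m%:R).

Definition prob_realizable (p : X -> R) (A : seq X -> X -> R) (m : nat) (eps : R)
  : \bar R :=
  \esum_(s in [set s : seq X | size s = m /\ dTV (A (msort s)) p <= eps])
     (prodp p s)%:E.

Definition prob_adv (p : X -> R) (V : seq X -> seq X -> R) (A : seq X -> X -> R)
  (m : nat) (err : R) : \bar R :=
  \esum_(s in [set s : seq X | size s = m])
    \esum_(t in [set t : seq X | dTV (A (msort t)) p <= err])
      (prodp p s * V (msort s) t)%:E.

Definition realizable_learnable_with (C : set (X -> R)) (mre : R -> R -> R) : Prop :=
  exists A, learner A /\
    forall p, C p -> forall eps delta : R, 0 < eps < 1 -> 0 < delta < 1 ->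
      forall m : nat, mre eps delta <= m%:R ->
        ((1 - delta)%:E <= prob_realizable p A m eps)%E.

Definition robust_guarantee (f : R -> R) (C : set (X -> R)) (A : seq X -> X -> R)
  (msc : R -> R -> nat) (V : seq X -> seq X -> R) (eta : R) : Prop :=
  forall p, C p -> forall eps delta : R, 0 < eps < 1 -> 0 < delta < 1 ->
    forall m : nat, (msc eps delta <= m)%N ->
      ((1 - delta)%:E <= prob_adv p V A m (f eta + eps))%E.

(* Budgets are restricted to [0,1], the domain of f. *)
Definition add_robust_learnable (f : R -> R) (C : set (X -> R)) : Prop :=
  exists A msc, learner A /\
    forall V eta, additive_adv V -> has_budget V eta -> 0 <= eta <= 1 ->
      robust_guarantee f C A msc V eta.

Definition sub_robust_learnable (f : R -> R) (C : set (X -> R)) : Prop :=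
  exists A msc, learner A /\
    forall V eta, subtractive_adv V -> has_budget V eta -> 0 <= eta <= 1 ->
      robust_guarantee f C A msc V eta.

Definition universal_adversary (f : R -> R) (C : set (X -> R))
  (V : seq X -> seq X -> R) (eta : R) : Prop :=
  forall A msc, learner A -> ~ robust_guarantee f C A msc V eta.

Definition enumerates_finsets (B : nat -> seq nat) : Prop :=
  (forall i, uniq (B i) /\ B i != [::]) /\
  (forall s : seq nat, uniq s -> s != [::] -> exists i, perm_eq (B i) s) /\
  (forall i i', perm_eq (B i) (B i') -> i = i').

(* p_{i,j,k} = (1 - 1/j) delta_(0,0) + (1/j - 1/k) U_{B_i x {2j+1}}
               + (1/k) delta_(i, 2j+2). *)
Definition pijk (B : nat -> seq nat) (i j k : nat) : X -> R := fun x =>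
  (if x == (0, 0)%N then 1 - (j%:R)^-1 else 0)
  + (if (x.2 == (2 * j).+1)%N && (x.1 \in B i)
     then ((j%:R)^-1 - (k%:R)^-1) / (size (B i))%:R else 0)
  + (if x == (i, (2 * j).+2)%N then (k%:R)^-1 else 0).

Definition Cg (B : nat -> seq nat) (g : nat -> nat) : set (X -> R) :=
  [set p | exists i j : nat, (0 < j)%N /\ p = pijk B i j (g j)].

End Defs.

(* Main.v *)
(* Only the distributions with j = 1 matter for (ii) and (iii), so g(j) = j + K suffices, where
   f(eta) <= 1/64 for some eta > 0 and K eta >= 4.

   Upper bound: a sample containing a point (i, 2j+2) identifies p_{i,j,g(j)}; otherwise
   answering delta_(0,0) is wrong by at most 1/j.

   Lower bound: the hard sets are the transversals B_om = {2a + om_a : a < M} of the pairs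
   {2a, 2a+1}, with M = 2m + 1.  Let om' be om reflected on all pairs that the sample does not
   meet; this is a measure preserving involution on pairs (om, sample).  The subtractive
   adversary erases all points (i, 4); the additive one adds as many copies of (i', 4), where i'
   is the index of the reflected set.  Either way the learner receives the same multiset from
   om and om', although the two distributions are far apart, hence fails for half of the om.
   By Markov's inequality the points (i, 4) exceed the budget with probability at most
   1/(K eta) <= 1/4. *)

Require Import Defs.
From HB Require Import structures.
From mathcomp Require Import all_boot all_order all_algebra.
From mathcomp Require Import all_classical all_reals all_analysis.
From mathcomp Require Import ring lra zify.
Set Implicit Arguments. Unset Strict Implicit. Unset Printing Implicit Defensive.
Import Order.TTheory GRing.Theory Num.Theory.
Import numFieldNormedType.Exports.
Local Open Scope classical_set_scope.
Local Open Scope ring_scope.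

(** * Finite mixtures of point masses *)

Section Mixtures.
Variable R : realType.

(** The law of [e o] when [o] has weights [w]. The map [e] may identify outcomes, and every sum
    against a mixture becomes a finite sum over [O]. *)
Definition mixture (T : eqType) (O : finType) (w : O -> R) (e : O -> T) : T -> R :=
  fun x => \sum_o w o * (x == e o)%:R.

Lemma mixture_ge0 (T : eqType) (O : finType) (w : O -> R) (e : O -> T) x :
  (forall o, 0 <= w o) -> 0 <= mixture w e x.
Proof. by move=> w0; apply: sumr_ge0 => o _; rewrite mulr_ge0 // ler0n. Qed.

Lemma esum_mixture (T : choiceType) (O : finType) (w : O -> R) (e : O -> T)
    (h : T -> R) :
  (forall o, 0 <= w o) -> (forall x, 0 <= h x) ->
  (\esum_(x in [set: T]) (mixture w e x * h x)%:E = (\sum_o w o * h (e o))%:E)%E.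
Proof.
move=> w0 h0.
rewrite -sumEFin.
have -> : (\esum_(x in [set: T]) (mixture w e x * h x)%:E
  = \esum_(x in [set: T]) \sum_o (w o * (x == e o)%:R * h x)%:E)%E.
  by apply: eq_esum => x _; rewrite sumEFin mulr_suml.
rewrite esum_sum; last first.
  by move=> x o _ _; rewrite lee_fin !mulr_ge0 // ler0n.
apply: eq_bigr => o _.
rewrite (_ : (w o * h (e o))%:E = \esum_(x in [set e o]) (w o * h x)%:E)%E; last first.
  by rewrite esum_set1 // lee_fin mulr_ge0.
rewrite [RHS]esum_mkcond; apply: eq_esum => x _.
have [->|xo] := eqVneq x (e o); first by rewrite mem_set // mulr1.
rewrite memNset ?mulr0 ?mul0r // => /= xeq; by rewrite xeq eqxx in xo.
Qed.

Lemma is_dist_mixture (T : choiceType) (O : finType) (w : O -> R) (e : O -> T) :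
  (forall o, 0 <= w o) -> \sum_o w o = 1 -> is_dist (mixture w e).
Proof.
move=> w0 w1; split=> [x|]; first exact: mixture_ge0.
have := esum_mixture e w0 (fun=> ler01); rewrite -big_distrl /= w1 mulr1 => <-.
by apply: eq_esum => x _; rewrite mulr1.
Qed.

(** Distributing the product over the sums gives one term for each choice [u] of outcomes, and the
    indicators multiply to the equality of the two sequences. *)
Lemma prodp_mixture (T : eqType) (O : finType) (w : O -> R) (e : O -> T) m (s : seq T) :
  size s = m ->
  \prod_(x <- s) mixture w e x =
  mixture (fun u : {ffun 'I_m -> O} => \prod_k w (u k))
    (fun u => [seq e (u k) | k <- enum 'I_m]) s.
Proof.
move=> sm.
pose t : m.-tuple T := tcast sm (in_tuple s).
have -> : s = t by rewrite val_tcast.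
rewrite big_tuple bigA_distr_bigA; apply: eq_bigr => u _ /=.
rewrite big_split /=; congr (_ * _).
have -> : (val t == [seq e (u k) | k <- enum 'I_m]) = [forall k, tnth t k == e (u k)].
  rewrite -[X in X == _](map_tnth_enum t).
  apply/eqP/forallP => [/eq_in_map teq k|teq]; first by apply/eqP/teq; rewrite mem_enum.
  by apply: eq_map => k; apply/eqP.
case: forallP => [teq|/forallP]; first by rewrite big1 // => k _; rewrite teq.
by rewrite negb_forall => /existsP[k /negbTE tk]; rewrite (bigD1 k) //= tk mul0r.
Qed.

(** Moves probabilities from samples to outcome vectors, where everything is finite. *)
Lemma esum_prodp (O : finType) (w : O -> R) (e : O -> X) m (h : seq X -> R) :
  (forall o, 0 <= w o) -> (forall s, 0 <= h s) ->
  (\esum_(s in [set s : seq X | size s = m]) (prodp (mixture w e) s * h s)%:E =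
   (\sum_(u : {ffun 'I_m -> O}) (\prod_k w (u k)) * h [seq e (u k) | k <- enum 'I_m])%:E)%E.
Proof.
move=> w0 h0; rewrite -esum_mixture //; last by move=> u; apply: prodr_ge0.
rewrite esum_mkcond; apply: eq_esum => s _.
have [sm|/eqP sm] := eqVneq (size s) m.
  by rewrite mem_set // /prodp (@prodp_mixture _ _ _ _ m).
rewrite memNset // /mixture big1 ?mul0r // => u _.
case: eqP => [sE|]; last by rewrite mulr0.
by case: sm; rewrite sE size_map size_enum_ord.
Qed.

Lemma sum_le_dTV (p q : X -> R) (E : seq X) : is_dist p -> is_dist q -> uniq E ->
  \sum_(x <- E) `|p x - q x| <= 2 * dTV p q.
Proof.
move=> [p0 p1] [q0 q1] uE; rewrite /dTV [2 * _]mulrC divfK //.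
(* [fine] sends an infinite sum to 0, so finiteness comes first: [|p - q| <= p + q], of total mass
   2. *)
rewrite -lee_fin fineK; last first.
  rewrite ge0_fin_numE; last by apply: esum_ge0 => x _; rewrite lee_fin.
  apply: (@le_lt_trans _ _ (1 + 1)%E); last by rewrite ltry.
  rewrite -{1}p1 -q1 -esumD; try by move=> x _; rewrite lee_fin.
  apply: le_esum => x _; rewrite -EFinD lee_fin (le_trans (ler_normB _ _)) //.
  by rewrite !ger0_norm.
apply: esum_ge; exists [set` E]; first by split; [exact: finite_seq|].
by rewrite -fsbig_seq // sumEFin.
Qed.

Lemma dTVxx (p : X -> R) : dTV p p = 0.
Proof. by rewrite /dTV esum1 ?mul0r // => x _; rewrite subrr normr0. Qed.

End Mixtures.

(** * Outcomes of a single draw *)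

Section Sampling.
Variable R : realType.

(* [inl true] is the point (i, 2j+2) revealing i, [inl false] is (0, 0), and [inr a] is the a-th
   element of B_i at level 2j+1. *)
Definition outcome M := (bool + 'I_M)%type.

Definition weight M (a b c : R) (o : outcome M) : R :=
  match o with inl true => b | inl false => a | inr _ => c end.

Definition pt M (e : 'I_M -> nat) (i j : nat) (o : outcome M) : X :=
  match o with
  | inl true => (i, (2 * j).+2) | inl false => (0, 0) | inr a => (e a, (2 * j).+1)
  end%N.

Lemma weight_ge0 M (a b c : R) (o : outcome M) :
  0 <= a -> 0 <= b -> 0 <= c -> 0 <= weight a b c o.
Proof. by case: o => [[]|]. Qed.

Lemma sum_weight M (a b c : R) :
  \sum_(o : outcome M) weight a b c o = a + b + M%:R * c.
Proof.
by rewrite big_sumType /= big_bool /= sumr_const card_ord addrC mulr_natl [b + a]addrC addrC.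
Qed.

(** The listing [e] of [B i] is left free: the upper bound lists by position, the lower bound by
    pairs, so that all hard distributions share the same outcomes and weights. *)
Lemma pijk_mixture (B : nat -> seq nat) i j k M (e : 'I_M -> nat) :
  (0 < j)%N ->
  uniq (B i) -> perm_eq (B i) [seq e a | a <- enum 'I_M] ->
  pijk R B i j k =
  mixture (weight (1 - j%:R^-1) k%:R^-1 ((j%:R^-1 - k%:R^-1) / M%:R)) (pt e i j).
Proof.
move=> j0 uB pB; apply/funext => x; rewrite /pijk /mixture big_sumType big_bool /=.
have -> : size (B i) = M by rewrite (perm_size pB) size_map size_enum_ord.
rewrite [LHS]addrAC [in RHS](addrC (k%:R^-1 * _)).
congr (_ + _ + _); first by case: eqP; rewrite ?mulr1 ?mulr0.
  by case: eqP; rewrite ?mulr1 ?mulr0.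
have eI : injective e.
  by apply/injectiveP; rewrite /injectiveb /dinjectiveb -(perm_uniq pB).
rewrite (perm_mem pB).
case: ifPn => [/andP[/eqP x2 /mapP[a _ x1]]|H].
  rewrite (bigD1 a) //= big1 ?addr0 => [|b ba].
    by rewrite -x1 -x2 -surjective_pairing eqxx mulr1.
  rewrite (_ : _ == _ = false) ?mulr0 //; apply: contra_neqF ba => /eqP xE.
  by apply: eI; rewrite -x1 xE.
rewrite big1 // => a _; case: eqP; rewrite ?mulr0 // => xE.
by case/negP: H; rewrite xE /= eqxx map_f // mem_enum.
Qed.

End Sampling.

(** * Independent draws of outcomes *)

Section IID.
Variable R : realType.

Lemma sum_iid_prod (O : finType) (w : O -> R) m (F : 'I_m -> O -> R) :
  \sum_(u : {ffun 'I_m -> O}) (\prod_k w (u k)) * (\prod_k F k (u k)) =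
  \prod_k \sum_o w o * F k o.
Proof.
rewrite bigA_distr_bigA; apply: eq_bigr => u _; by rewrite big_split.
Qed.

Lemma sum_iid (O : finType) (w : O -> R) m : \sum_o w o = 1 ->
  \sum_(u : {ffun 'I_m -> O}) \prod_k w (u k) = 1.
Proof.
move=> w1; have := sum_iid_prod w (fun (_ : 'I_m) _ => 1).
rewrite [X in _ = X]big1 => [h|k _]; last by rewrite -mulr_suml w1 mulr1.
rewrite -[RHS]h; by apply: eq_bigr => u _; rewrite big1_eq mulr1.
Qed.

Lemma sum_iid_avoid (O : finType) (w : O -> R) m t : \sum_o w o = 1 ->
  \sum_(u : {ffun 'I_m -> O}) (\prod_k w (u k)) * (\prod_k (u k != t)%:R) = (1 - w t) ^+ m.
Proof.
move=> w1; rewrite (sum_iid_prod w (fun _ o => (o != t)%:R)).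
rewrite prodr_const card_ord; congr (_ ^+ _).
rewrite -[X in _ = X - _]w1 [in RHS](bigD1 t) //= addrC addrK (bigD1 t) //= eqxx mulr0 add0r.
by apply: eq_bigr => o ->; rewrite mulr1.
Qed.

Lemma expected_count (O : finType) (w : O -> R) m t : \sum_o w o = 1 ->
  \sum_(u : {ffun 'I_m -> O}) (\prod_k w (u k)) * (\sum_k (u k == t)%:R) = m%:R * w t.
Proof.
move=> w1; under eq_bigr => u _ do rewrite mulr_sumr.
rewrite exchange_big /=.
rewrite (eq_bigr (fun=> w t)) => [|k _]; first by rewrite sumr_const card_ord mulr_natl.
(* The indicator of a hit at [k] is a product over all coordinates with trivial factors off [k]. *)
transitivity (\prod_(l < m) \sum_o w o * (if l == k then (o == t)%:R else 1)).
  rewrite -(sum_iid_prod w (fun l o => if l == k then (o == t)%:R else 1)).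
  apply: eq_bigr => u _; congr (_ * _).
  by rewrite (bigD1 k) //= eqxx big1 ?mulr1 // => l /negbTE ->.
rewrite (bigD1 k) //= eqxx [X in _ * X]big1 => [|l lk].
  by rewrite mulr1 (bigD1 t) //= eqxx mulr1 big1 ?addr0 // => o /negbTE ->; rewrite mulr0.
by rewrite -[RHS]w1 (negbTE lk); apply: eq_bigr => o _; rewrite mulr1.
Qed.

(** Pushing two weightings forward along the same map cannot increase their L1 distance. *)
Lemma dTV_mixture_le (O : finType) (w w' : O -> R) (e : O -> X) :
  dTV (mixture w e) (mixture w' e) <= (\sum_o `|w o - w' o|) / 2.
Proof.
rewrite /dTV ler_wpM2r //.
set S := esum _ _.
have S0 : (0 <= S)%E by apply: esum_ge0 => x _; rewrite lee_fin.
have SE : (S <= (\sum_o `|w o - w' o|)%:E)%E.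
  have := @esum_mixture R X O (fun o => `|w o - w' o|) e (fun=> 1) (fun=> normr_ge0 _) (fun=> ler01).
  rewrite -big_distrl /= mulr1 => <-.
  apply: le_esum => x _; rewrite lee_fin mulr1 /mixture -sumrB.
  apply: (le_trans (ler_norm_sum _ _ _)); apply: ler_sum => o _.
  by rewrite -mulrBl normrM [X in _ * X]ger0_norm ?ler0n.
rewrite -lee_fin fineK // ge0_fin_numE //.
exact: le_lt_trans SE (ltry _).
Qed.

End IID.

(** * Realizable learnability *)

Section Realizable.
Variables (R : realType) (B : nat -> seq nat).
Hypothesis Benum : enumerates_finsets B.

Lemma map_nth_ord (T : Type) (x : T) (s : seq T) :
  [seq nth x s (val a) | a <- enum 'I_(size s)] = s.
Proof. by rewrite -[RHS](mkseq_nth x s) /mkseq -val_enum_ord -map_comp. Qed.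

Lemma weight_dist M j k : (0 < M)%N -> (0 < j <= k)%N ->
  let w := @weight R M (1 - j%:R^-1) k%:R^-1 ((j%:R^-1 - k%:R^-1) / M%:R) in
  (forall o, 0 <= w o) /\ \sum_o w o = 1.
Proof.
move=> M0 /andP[j0 jk] w; split.
  move=> o; apply: weight_ge0.
  - by rewrite subr_ge0 invf_le1 ?ltr0n // ler1n.
  - by rewrite invr_ge0.
  - by rewrite divr_ge0 // subr_ge0 lef_pV2 ?posrE ?ltr0n ?ler_nat //; lia.
rewrite sum_weight.
have M1 : M%:R != 0 :> R by rewrite pnatr_eq0; lia.
rewrite mulrCA divff //; lra.
Qed.

Definition delta00 : X -> R := fun x => (x == (0, 0)%N)%:R.

Lemma delta00_mixture M (e : 'I_M -> nat) i j :
  delta00 = mixture (weight 1 0 0) (pt e i j).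
Proof.
apply/funext => x; rewrite /delta00 /mixture big_sumType big_bool /=.
rewrite mul0r add0r mul1r big1 ?addr0 // => a _; by rewrite mul0r.
Qed.

Lemma delta00_dist : is_dist delta00.
Proof.
rewrite (@delta00_mixture 0 (fun=> 0%N) 0 0); apply: is_dist_mixture.
  by move=> o; apply: weight_ge0.
by rewrite sum_weight; lra.
Qed.

Lemma B_uniq i : uniq (B i). Proof. by case: Benum => /(_ i)[]. Qed.
Lemma B_gt0 i : (0 < size (B i))%N.
Proof. by case: Benum => /(_ i)[_]; case: (B i). Qed.

Lemma pijk_mixture_nth i j k : (0 < j)%N ->
  pijk R B i j k =
  mixture (weight (1 - j%:R^-1) k%:R^-1 ((j%:R^-1 - k%:R^-1) / (size (B i))%:R))
    (pt (fun a : 'I_(size (B i)) => nth 0%N (B i) a) i j).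
Proof. by move=> j0; apply: pijk_mixture; rewrite ?B_uniq ?map_nth_ord. Qed.

Lemma pijk_dist i j k : (0 < j <= k)%N -> is_dist (pijk R B i j k).
Proof.
move=> jk; case: (weight_dist (B_gt0 i) jk) => w0 w1.
by rewrite pijk_mixture_nth; [exact: is_dist_mixture|case/andP: jk].
Qed.

(** Over the common outcomes the L1 distance is 1/j + 1/k + (1/j - 1/k) = 2/j. *)
Lemma dTV_delta00_pijk i j k : (0 < j <= k)%N ->
  dTV delta00 (pijk R B i j k) <= j%:R^-1.
Proof.
move=> /andP[j0 jk]; rewrite pijk_mixture_nth // (delta00_mixture
  (fun a : 'I_(size (B i)) => nth 0%N (B i) a) i j).
apply: (le_trans (dTV_mixture_le _ _ _)).
rewrite big_sumType big_bool /= !sub0r !normrN.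
have kj : k%:R^-1 <= j%:R^-1 :> R by rewrite lef_pV2 ?posrE ?ltr0n ?ler_nat //; lia.
have k0 : 0 <= k%:R^-1 :> R by rewrite invr_ge0.
have M1 : (size (B i))%:R != 0 :> R by rewrite pnatr_eq0 -lt0n B_gt0.
rewrite sumr_const card_ord -[X in _ + X]mulr_natl opprB [1 + _]addrC addrNK.
rewrite !ger0_norm ?divr_ge0 ?subr_ge0 ?(le_trans k0 kj) //.
by rewrite mulrCA divff //; lra.
Qed.

(** The levels 2j+2 with [j >= 1]: even and at least 4. This leaves out (0, 0) and all levels
    2j+1. *)
Definition is_tell (x : X) := (3 < x.2)%N && ~~ odd x.2.

Definition read_tell (g : nat -> nat) (S : seq X) : X -> R :=
  if has is_tell S then
    let x := nth (0, 0)%N S (find is_tell S) in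
    pijk R B x.1 (x.2./2).-1 (g (x.2./2).-1)
  else delta00.

Lemma read_tell_learner g : (forall j, (0 < j)%N -> (j <= g j)%N) ->
  learner (read_tell g).
Proof.
move=> jg S; rewrite /read_tell; case: ifP => [hS|_]; last exact: delta00_dist.
have /andP[x3 _] := nth_find (0, 0)%N hS.
set x := nth _ _ _ in x3 *.
have j0 : (0 < (x.2./2).-1)%N by lia.
by apply: pijk_dist; rewrite j0 jg.
Qed.

Lemma is_tell_pt M (e : 'I_M -> nat) i j o : (0 < j)%N ->
  is_tell (pt e i j o) = (o == inl true).
Proof.
move=> j0; case: o => [[]|a] /=; rewrite /is_tell /= ?mul2n ?odd_double ?andbF //=.
by rewrite eqxx; lia.
Qed.

Lemma read_tell_sample g M (e : 'I_M -> nat) i j m (u : 'I_m -> outcome M) : (0 < j)%N ->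
  read_tell g (msort [seq pt e i j (u k) | k <- enum 'I_m]) =
  if [exists k, u k == inl true] then pijk R B i j (g j) else delta00.
Proof.
move=> j0; rewrite /read_tell; set S := msort _.
have SE x : x \in S -> exists k, x = pt e i j (u k).
  by rewrite mem_sort => /mapP[k _ ->]; exists k.
have -> : has is_tell S = [exists k, u k == inl true].
  apply/hasP/existsP => [[x /SE[k ->]]|[k uk]]; first by rewrite is_tell_pt //; exists k.
  exists (pt e i j (u k)); last by rewrite is_tell_pt.
  by rewrite mem_sort; apply/mapP; exists k; rewrite ?mem_enum.
case: ifPn => // /existsP[k uk].
have hS : has is_tell S.
  apply/hasP; exists (pt e i j (u k)); last by rewrite is_tell_pt.
  by rewrite mem_sort; apply/mapP; exists k; rewrite ?mem_enum.
have := nth_find (0, 0)%N hS.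
have /SE[l ->] : nth (0, 0)%N S (find is_tell S) \in S by rewrite mem_nth // -has_find.
rewrite is_tell_pt // => /eqP -> /=.
by rewrite mul2n doubleK.
Qed.

Lemma Cg_realizable (g : nat -> nat) :
  {homo g : a b / (a <= b)%N} -> (forall j, (0 < j)%N -> (j <= g j)%N) ->
  realizable_learnable_with (@Cg R B g)
      (fun eps delta => ln (delta^-1) * (g `|Num.ceil (eps^-1)|%N)%:R).
Proof.
move=> gmono jg; exists (read_tell g); split; first exact: read_tell_learner.
move=> p [i [j [j0 ->{p}]]] eps delta /andP[e0 e1] /andP[d0 d1] m hm.
have jk : (0 < j <= g j)%N by rewrite j0 jg.
have [w0 w1] := weight_dist (B_gt0 i) jk.
have pE := pijk_mixture_nth i (g j) j0.
set w := weight _ _ _ in w0 w1 pE; set e := (fun _ => nth _ _ _) in pE.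
set p := pijk R B i j (g j) in pE *.
rewrite /prob_realizable.
rewrite (_ : esum _ _ = \esum_(s in [set s : seq X | size s = m])
   (prodp (mixture w (pt e i j)) s * (dTV (read_tell g (msort s)) p <= eps)%R%:R)%:E)%E; last first.
  rewrite esum_mkcond [RHS]esum_mkcond; apply: eq_esum => s _; rewrite -pE.
  have [sm|/eqP sm] := eqVneq (size s) m; last first.
    by rewrite memNset => [|[//]]; rewrite memNset.
  rewrite [in RHS]mem_set //.
  case: (boolP (dTV _ _ <= _)) => dle; first by rewrite mem_set ?mulr1.
  by rewrite memNset ?mulr0 // => -[_] /=; apply/negP.
rewrite esum_prodp //.
rewrite lee_fin.
under eq_bigr => u _ do rewrite read_tell_sample //.
(* If 1/j is at most [eps], both possible answers are accurate; otherwise only a sample without a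
   revealing point can fail. *)
have [je|ej] := leP (j%:R^-1) eps.
  rewrite (eq_bigr (fun u : {ffun 'I_m -> _} => \prod_k w (u k))) => [|u _].
    by rewrite sum_iid //; lra.
  case: ifP => _; first by rewrite dTVxx ltW ?mulr1.
  by rewrite (le_trans (dTV_delta00_pijk i jk) je) mulr1.
have W0 (u : {ffun 'I_m -> outcome (size (B i))}) : 0 <= \prod_k w (u k).
  by apply: prodr_ge0 => k _.
apply: (@le_trans _ _ (\sum_(u : {ffun 'I_m -> outcome (size (B i))})
   (\prod_k w (u k) - (\prod_k w (u k)) * \prod_k (u k != inl true)%:R))); last first.
  apply: ler_sum => u _; rewrite -{1}[\prod_k w (u k)]mulr1 -mulrBr ler_wpM2l //.
  case: ifPn => [_|/existsPn nt]; first by rewrite dTVxx (ltW e0) lerBlDr lerDl prodr_ge0.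
  by rewrite (eq_bigr (fun=> 1)) => [|k _]; [rewrite big1_eq subrr|rewrite nt].
rewrite big_split /= sumrN sum_iid // sum_iid_avoid // lerD2l lerN2.
have -> : w (inl true) = (g j)%:R^-1 by [].
have k0 : (0 < g j)%N by case/andP: jk; apply: leq_trans.
have h1 : 0 <= 1 - (g j)%:R^-1 :> R by rewrite subr_ge0 invf_le1 ?ltr0n // ler1n.
(* No draw reveals [i] with probability (1 - 1/g(j))^m <= exp(-m/g(j)), which the bound on [m] makes
   at most [delta]. *)
apply: (@le_trans _ _ (expR (- (g j)%:R^-1) ^+ m)).
  by apply: lerXn2r; rewrite ?nnegrE ?expR_ge0 // expR_ge1Dx.
rewrite -expRM_natl -ler_ln ?posrE ?expR_gt0 // expRK.
have ld : 0 < ln delta^-1 by rewrite ln_gt0 // invf_gt1.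
have -> : ln delta = - ln delta^-1 by rewrite lnV ?posrE // opprK.
rewrite mulrN lerN2 ler_pdivlMr ?ltr0n //.
apply: le_trans hm; rewrite ler_wpM2l ?ler_nat ?ltW //.
(* In this case j < 1/eps, hence [j] is at most the ceiling of 1/eps. *)
apply: gmono.
have : j%:R <= eps^-1 by rewrite -[j%:R]invrK lef_pV2 ?posrE ?invr_gt0 ?ltr0n ?ltW.
move=> /le_trans/(_ (ceil_ge _)).
have : 0 < Num.ceil eps^-1 by rewrite ceil_gt0 invr_gt0.
by case: (Num.ceil _) => // n _; rewrite -pmulrn ler_nat absz_nat.
Qed.
End Realizable.

(** * Adversaries that hide a reflection *)

Lemma lexle_total : total lexle.
Proof. by move=> x y; rewrite /lexle; case: ltngtP => //= _; exact: leq_total. Qed.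

Lemma lexle_trans : transitive lexle.
Proof. move=> y x z; rewrite /lexle; lia. Qed.

Lemma lexle_anti : antisymmetric lexle.
Proof. by move=> [a b] [c d]; rewrite /lexle /= => H; congr pair; lia. Qed.

Lemma msort_eq s t : perm_eq s t -> msort s = msort t.
Proof. by move/(perm_sortP lexle_total lexle_trans lexle_anti). Qed.

(** * Transversals of pairs and their reflections *)

Section Selectors.
Variable B : nat -> seq nat.
Hypothesis Benum : enumerates_finsets B.

Definition index_of (b : seq nat) : nat := xget 0%N [set i | perm_eq (B i) b].

Lemma index_of_eq i b : perm_eq (B i) b -> index_of b = i.
Proof.
move=> ib; apply: xget_unique => // l /= lb; case: Benum => _ [_]; apply.
by rewrite (perm_trans lb) // perm_sym.
Qed.

Lemma perm_index_of b : uniq b -> b != [::] -> perm_eq (B (index_of b)) b.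
Proof.
move=> ub b0; have [_ [/(_ b ub b0)[i ib] _]] := Benum.
by rewrite (index_of_eq ib).
Qed.

(** Halving recovers the pair and parity recovers the choice, so a number can be reflected without
    knowing [om]. *)
Definition selector M (om : {ffun 'I_M -> bool}) (a : 'I_M) : nat := (om a + a.*2)%N.

Definition selection M (om : {ffun 'I_M -> bool}) := [seq selector om a | a <- enum 'I_M].

Lemma selector_half M (om : {ffun 'I_M -> bool}) a : (selector om a)./2 = a.
Proof. by rewrite /selector half_bit_double. Qed.

Lemma selector_odd M (om : {ffun 'I_M -> bool}) a : odd (selector om a) = om a.
Proof. by rewrite /selector oddD odd_double addbF oddb. Qed.

Lemma selector_eq M (om om' : {ffun 'I_M -> bool}) a b :
  selector om a = selector om' b -> a = b /\ om a = om' a.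
Proof.
move=> E; have ab : a = b by apply: val_inj; rewrite /= -(selector_half om) E selector_half.
by split=> //; rewrite -selector_odd E -ab selector_odd.
Qed.

Lemma perm_selection M (om : {ffun 'I_M -> bool}) : (0 < M)%N ->
  perm_eq (B (index_of (selection om))) (selection om).
Proof.
move=> M0; apply: perm_index_of.
  by rewrite map_inj_uniq ?enum_uniq // => a b /selector_eq[].
by rewrite -size_eq0 size_map size_enum_ord -lt0n.
Qed.

Definition hit M m (u : 'I_m -> outcome M) (a : 'I_M) : bool := [exists k, u k == inr a].

Definition reflect_off M m (u : 'I_m -> outcome M) (om : {ffun 'I_M -> bool}) :
  {ffun 'I_M -> bool} := [ffun a => if hit u a then om a else ~~ om a].

Lemma reflect_offK M m (u : 'I_m -> outcome M) : involutive (reflect_off u).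
Proof. by move=> om; apply/ffunP => a; rewrite !ffunE; case: (hit u a); rewrite ?negbK. Qed.

(** Through [inr] the hit indices embed into the image of [u], which has at most [m] elements. *)
Lemma card_hit M m (u : 'I_m -> outcome M) : (#|hit u| <= m)%N.
Proof.
rewrite -[X in (_ <= X)%N](card_ord m).
apply: leq_trans (leq_image_card u 'I_m).
have inrI : injective (@inr bool 'I_M) by move=> ? ? [].
rewrite -(fintype.card_image inrI); apply: subset_leq_card.
apply/fintype.subsetP => o; case/fintype.imageP => [a /existsP[k /eqP uk] ->].
by rewrite -uk; apply: codom_f.
Qed.

Definition sample M m (om : {ffun 'I_M -> bool}) (u : 'I_m -> outcome M) : seq X :=
  [seq pt (selector om) (index_of (selection om)) 1 (u k) | k <- enum 'I_m].

Definition body (S : seq X) : seq nat := [seq x.1 | x <- S & x.2 == 3].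

(* Acts as [reflect_off] on selections but is computed from the sample alone, as the adversary
   knows neither [M] nor [om]. *)
Definition toggle (D : seq nat) (y : nat) : nat :=
  if y./2 \in [seq d./2 | d <- D] then y else (~~ odd y + y./2.*2)%N.

(** The halves of the level 3 points of the sample are exactly the pairs that [u] hits. *)
Lemma toggle_selector M m (om : {ffun 'I_M -> bool}) (u : 'I_m -> outcome M) S a :
  perm_eq S (sample om u) ->
  toggle (body S) (selector om a) = selector (reflect_off u om) a.
Proof.
move=> pS; rewrite /toggle selector_half selector_odd /selector ffunE.
suff -> : (val a \in [seq d./2 | d <- body S]) = hit u a by case: ifP.
apply/mapP/existsP => [[d]|[k /eqP uk]].
  move=> /mapP[x]; rewrite mem_filter (perm_mem pS) => /andP[x3 /mapP[k _ xE]] dE aE.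
  exists k; move: x3 dE; rewrite xE; case: (u k) => [[]|c] //= _ dE.
  by apply/eqP; congr inr; apply: val_inj; rewrite /= aE dE selector_half.
exists (selector om a); last by rewrite selector_half.
apply/mapP; exists (selector om a, 3)%N => //.
rewrite mem_filter (perm_mem pS) /=; apply/mapP; exists k; rewrite ?mem_enum //.
by rewrite uk.
Qed.

Lemma index_toggle M m (om : {ffun 'I_M -> bool}) (u : 'I_m -> outcome M) S :
  (0 < M)%N -> perm_eq S (sample om u) ->
  index_of [seq toggle (body S) y | y <- B (index_of (selection om))] =
  index_of (selection (reflect_off u om)).
Proof.
move=> M0 pS; apply: index_of_eq.
apply: perm_trans (perm_selection _ M0) _; rewrite perm_sym.
apply: perm_trans (perm_map _ (perm_selection _ M0)) _.
rewrite -map_comp (eq_map (g := selector (reflect_off u om))) // => a.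
exact: toggle_selector.
Qed.

Definition n_tells M m (u : 'I_m -> outcome M) : nat := (\sum_k (u k == inl true))%N.

Lemma size_n_tells M m (om : {ffun 'I_M -> bool}) (u : 'I_m -> outcome M) :
  size [seq x <- sample om u | is_tell x] = n_tells u.
Proof.
rewrite size_filter count_map -sum1_count big_mkcond /= big_enum /=.
by apply: eq_bigr => k _; rewrite is_tell_pt //; case: eqP.
Qed.

(** Reflection changes [om] only on pairs that contribute no point, so only the revealing points can
    differ. *)
Lemma body_sample M m (om : {ffun 'I_M -> bool}) (u : 'I_m -> outcome M) :
  [seq x <- sample (reflect_off u om) u | ~~ is_tell x] =
  [seq x <- sample om u | ~~ is_tell x].
Proof.
rewrite /sample; elim: (enum _) => //= k s ->.
rewrite !is_tell_pt //; case uk: (u k) => [[]|a] //=; congr (_ :: _).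
rewrite /selector ffunE; case: ifPn => // /existsPn/(_ k); by rewrite uk eqxx.
Qed.

Lemma tells_sample M m (om : {ffun 'I_M -> bool}) (u : 'I_m -> outcome M) :
  [seq x <- sample om u | is_tell x] = nseq (n_tells u) (index_of (selection om), 4)%N.
Proof.
rewrite -(size_n_tells om); apply/all_pred1P/allP => x.
rewrite mem_filter => /andP[xt /mapP[k _ xE]]; move: xt; rewrite xE is_tell_pt // => /eqP -> /=.
exact: eqxx.
Qed.

(** * The additive and the subtractive adversary *)

Variable R : realType.
Variable eta : R.

Definition budget (S : seq X) : nat := Num.truncn (eta * (size S)%:R).

Definition fake (S : seq X) (x : X) : X :=
  (index_of [seq toggle (body S) y | y <- B x.1], x.2).

(** Padding with (0, 0) makes the output size depend on [size S] alone. If the revealing points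
    exceed the budget, only padding is added. *)
Definition add_fakes (S : seq X) : seq X :=
  let T := [seq x <- S | is_tell x] in
  S ++ (if (size T <= budget S)%N
        then [seq fake S x | x <- T] ++ nseq (budget S - size T) (0, 0)%N
        else nseq (budget S) (0, 0)%N).

(** [take] fixes the output size: erasing at most [budget S] points leaves at least
    [size S - budget S] of them. *)
Definition hide_tells (S : seq X) : seq X :=
  take (size S - budget S)
    (if (size [seq x <- S | is_tell x] <= budget S)%N
     then [seq x <- S | ~~ is_tell x] else S).

Definition hiding (v : seq X -> seq X) :=
  forall M m (om : {ffun 'I_M -> bool}) (u : 'I_m -> outcome M), (0 < M)%N ->
    (n_tells u <= Num.truncn (eta * m%:R))%N ->
    perm_eq (v (msort (sample om u))) (v (msort (sample (reflect_off u om) u))).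

Lemma size_sample M m (om : {ffun 'I_M -> bool}) (u : 'I_m -> outcome M) :
  size (sample om u) = m.
Proof. by rewrite size_map size_enum_ord. Qed.

Lemma filter_msort (p : pred X) s : [seq x <- msort s | p x] = msort [seq x <- s | p x].
Proof. by rewrite /msort (filter_sort lexle_total lexle_trans). Qed.

(** Without revealing points the two sorted samples are literally equal, hence so are their
    prefixes. *)
Lemma hide_tells_hiding : hiding hide_tells.
Proof.
move=> M m om u M0 ut.
rewrite /hide_tells /budget !filter_msort !size_sort !size_n_tells !size_sample ut.
by rewrite body_sample.
Qed.

Lemma fakes_sample M m (om : {ffun 'I_M -> bool}) (u : 'I_m -> outcome M) : (0 < M)%N ->
  [seq fake (msort (sample om u)) x | x <- [seq x <- msort (sample om u) | is_tell x]] =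
  nseq (n_tells u) (index_of (selection (reflect_off u om)), 4)%N.
Proof.
move=> M0; rewrite filter_msort tells_sample.
have -> n (x : X) : msort (nseq n x) = nseq n x.
  have /all_pred1P -> : all (pred1 x) (msort (nseq n x)).
    by rewrite all_sort all_pred1_nseq.
  by rewrite size_sort size_nseq.
by rewrite map_nseq /fake /= (@index_toggle _ _ om u) // perm_sort.
Qed.

Lemma sample_split M m (om : {ffun 'I_M -> bool}) (u : 'I_m -> outcome M) :
  perm_eq (msort (sample om u))
   (nseq (n_tells u) (index_of (selection om), 4)%N ++ [seq x <- sample om u | ~~ is_tell x]).
Proof. by rewrite perm_sort -tells_sample perm_sym perm_filterC. Qed.

(** Since reflection is an involution, the fakes for the reflected sample are the true revealing
    points of [om]. Both outputs thus consist of the common body, the points of both indices in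
    equal number, and the same padding. *)
Lemma add_fakes_hiding : hiding add_fakes.
Proof.
move=> M m om u M0 ut.
rewrite /add_fakes !fakes_sample // reflect_offK.
rewrite /budget !filter_msort !size_sort !size_n_tells !size_sample ut !catA.
apply: perm_cat => //.
apply: perm_trans (perm_cat (sample_split om u) (perm_refl _)) _.
rewrite perm_sym.
apply: perm_trans (perm_cat (sample_split _ u) (perm_refl _)) _.
by rewrite body_sample -[X in perm_eq _ X]catA perm_catC perm_cat2l perm_catC.
Qed.

Definition dirac_adv (v : seq X -> seq X) : seq X -> seq X -> R :=
  fun S => mixture (fun _ : unit => 1) (fun _ => v S).

Lemma dirac_adv_gt0 v S T : 0 < dirac_adv v S T -> T = v S.
Proof.
rewrite /dirac_adv /mixture big_const card_unit /= addr0 mul1r.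
by case: eqP => //; rewrite ltxx.
Qed.

Lemma dirac_adv_adversary v : adversary (dirac_adv v).
Proof.
by move=> S; apply: is_dist_mixture => //; rewrite sumr_const card_unit.
Qed.

Hypothesis eta01 : 0 < eta <= 1.

Lemma budget_le S : (budget S <= size S)%N.
Proof.
case/andP: eta01 => e0 e1; rewrite -(ler_nat R).
apply: (@le_trans _ _ (eta * (size S)%:R)); last by rewrite ler_piMl.
by rewrite truncn_le mulr_ge0 // ltW.
Qed.

Lemma truncn_budget m : let b := Num.truncn (eta * m%:R) in
  eta * m%:R - 1 < b%:R /\ b%:R <= eta * m%:R.
Proof.
case/andP: eta01 => e0 e1 b.
have : b%:R <= eta * m%:R < b.+1%:R by apply: truncn_itv; rewrite mulr_ge0 // ltW.
by case/andP => b1 b2; split=> //; rewrite ltrBlDr natr1.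
Qed.

Lemma size_add_fakes S : size (add_fakes S) = (size S + budget S)%N.
Proof.
rewrite /add_fakes size_cat; case: ifP => h; last by rewrite size_nseq.
by rewrite size_cat size_map size_nseq subnKC.
Qed.

Lemma size_hide_tells S : size (hide_tells S) = (size S - budget S)%N.
Proof.
rewrite /hide_tells size_take_min; apply/minn_idPl; case: ifP => h; last exact: leq_subr.
have := count_predC is_tell S; rewrite -!size_filter => <-.
by rewrite leq_subLR leq_add2r.
Qed.

Lemma add_fakes_additive :
  additive_adv (dirac_adv add_fakes) /\ has_budget (dirac_adv add_fakes) eta.
Proof.
split.
  split; first exact: dirac_adv_adversary.
  move=> S T /dirac_adv_gt0 -> x; rewrite count_cat; exact: leq_addr.
exists (fun m => (m + Num.truncn (eta * m%:R))%N); split.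
  by move=> S T /dirac_adv_gt0 ->; rewrite size_add_fakes.
move=> m; rewrite natrD addrAC subrr add0r ger0_norm ?ler0n //; exact: truncn_budget.
Qed.

Lemma hide_tells_subtractive :
  subtractive_adv (dirac_adv hide_tells) /\ has_budget (dirac_adv hide_tells) eta.
Proof.
split.
  split; first exact: dirac_adv_adversary.
  move=> S T /dirac_adv_gt0 -> x; rewrite /hide_tells.
  apply: (@leq_trans (count_mem x (if (size [seq x <- S | is_tell x] <= budget S)%N
     then [seq x <- S | ~~ is_tell x] else S))).
    by rewrite -[X in (_ <= count_mem x X)%N](cat_take_drop (size S - budget S)) count_cat leq_addr.
  case: ifP => // _; exact/leq_count_subseq/filter_subseq.
exists (fun m => (m - Num.truncn (eta * m%:R))%N); split.
  by move=> S T /dirac_adv_gt0 ->; rewrite size_hide_tells.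
move=> m; have := budget_le (nseq m (0, 0)%N); rewrite /budget size_nseq => bm.
rewrite natrB // addrAC subrr add0r normrN ger0_norm ?ler0n //; exact: truncn_budget.
Qed.

End Selectors.

(** * Failure of every learner *)

Section LowerBound.
Variables (R : realType) (B : nat -> seq nat).
Hypothesis Benum : enumerates_finsets B.

Definition hard_dist K M (om : {ffun 'I_M -> bool}) : X -> R :=
  pijk R B (index_of B (selection om)) 1 K.

Lemma hard_dist_dist K M (om : {ffun 'I_M -> bool}) : (0 < K)%N ->
  is_dist (hard_dist K om).
Proof. by move=> K0; apply: pijk_dist. Qed.

Lemma hard_dist_body K M (om om' : {ffun 'I_M -> bool}) a : (0 < M)%N ->
  hard_dist K om (selector om' a, 3)%N =
  if om a == om' a then (1 - K%:R^-1) / M%:R else 0.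
Proof.
move=> M0; rewrite /hard_dist /pijk /= invr1 !xpair_eqE !andbF /= addr0 add0r.
have pB := perm_selection Benum om M0.
rewrite (perm_mem pB) (perm_size pB) size_map size_enum_ord.
suff -> : (selector om' a \in selection om) = (om a == om' a) by [].
apply/mapP/eqP => [[b _ /selector_eq[-> ->]]//|oa].
by exists a; rewrite ?mem_enum // /selector oa.
Qed.

(* On the points of the first set outside the second, [q] pays either for missing the first
   distribution or for exceeding the second. *)
Lemma hard_dist_separated K M m (u : 'I_m -> outcome M) (om : {ffun 'I_M -> bool})
    (q : X -> R) :
  is_dist q -> (1 < K)%N -> (m.*2 < M)%N ->
  1 / 8 < dTV q (hard_dist K om) + dTV q (hard_dist K (reflect_off u om)).
Proof.
move=> qd K1 mM; have M0 : (0 < M)%N by lia.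
have K0 : (0 < K)%N by lia.
(* On the pairs that [u] misses, the two sets are disjoint. *)
pose E := [seq (selector om a, 3)%N | a <- enum 'I_M & ~~ hit u a].
have uE : uniq E.
  by rewrite map_inj_uniq; [exact/filter_uniq/enum_uniq|move=> a b [/selector_eq[]]].
have sE : (M - m <= size E)%N.
  have := card_hit u; rewrite size_map size_filter.
  have := count_predC (hit u) (enum 'I_M); rewrite size_enum_ord.
  have -> : count (hit u) (enum 'I_M) = #|hit u|.
    by rewrite -size_filter cardE enumT.
  by set b := count _ _; lia.
have d1 := sum_le_dTV qd (hard_dist_dist om K0) uE.
have d2 := sum_le_dTV qd (hard_dist_dist (reflect_off u om) K0) uE.
pose c : R := (1 - K%:R^-1) / M%:R.
have sc : (size E)%:R * c <= \sum_(x <- E) `|q x - hard_dist K om x| +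
    \sum_(x <- E) `|q x - hard_dist K (reflect_off u om) x|.
  rewrite -big_split /= /E !big_map !size_map.
  rewrite -sum1_size natr_sum mulr_suml !big_filter; apply: ler_sum => a ua.
  rewrite !hard_dist_body // eqxx ffunE (negbTE ua).
  rewrite (_ : (~~ om a == om a) = false); last by case: (om a).
  rewrite subr0 mul1r -/c -[X in X <= _](subrK (q (selector om a, 3)%N)) lerD //.
    by rewrite distrC ler_norm.
  exact: ler_norm.
have Kh : K%:R^-1 <= 2^-1 :> R by rewrite lef_pV2 ?posrE ?ltr0n // ler_nat.
have MR : 0 < M%:R :> R by rewrite ltr0n.
have c0 : 0 <= 1 - K%:R^-1 :> R by lra.
(* More than half of the [M] points are in [E], and 1 - 1/K >= 1/2. The factor 2 of [sum_le_dTV]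
   turns 1/4 into 1/8. *)
have : 4^-1 < (size E)%:R * c.
  rewrite /c mulrA ltr_pdivlMr //.
  have sR : M%:R < 2 * (size E)%:R :> R by rewrite -natrM ltr_nat; lia.
  nra.
lra.
Qed.

(** Within the budget, the involution pairs each success with a failure. Beyond it the quotient
    exceeds 1 and the bound is trivial; in this additive form its mean over [u] yields Markov's
    inequality. *)
Lemma average_success m M (eta : R)
    (u : 'I_m -> outcome M) (good : {ffun 'I_M -> bool} -> bool) :
  0 < eta * m%:R ->
  ((n_tells u <= Num.truncn (eta * m%:R))%N ->
    forall om, ~~ (good om && good (reflect_off u om))) ->
  \sum_om (good om)%:R <=
    #|{ffun 'I_M -> bool}|%:R * (2^-1 + (n_tells u)%:R / (eta * m%:R)).
Proof.
move=> em0 sep; set N := #|_|.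
have sN : \sum_(om : {ffun 'I_M -> bool}) (1 : R) = N%:R by rewrite sumr_const.
have [ut|ut] := leqP (n_tells u) (Num.truncn (eta * m%:R)).
  apply: (@le_trans _ _ (N%:R * 2^-1)); last first.
    by rewrite ler_wpM2l ?ler0n // lerDl divr_ge0 // ltW.
  rewrite ler_pdivlMr // mulr_natr mulr2n.
  rewrite {2}(reindex_inj (inv_inj (reflect_offK u))) /= -big_split /= -sN.
  apply: ler_sum => om _; have := sep ut om.
  by case: (good om); case: (good _); rewrite //= ?addr0 ?add0r.
apply: (@le_trans _ _ N%:R).
  by rewrite -sN; apply: ler_sum => om _; rewrite lern1 leq_b1.
rewrite ler_peMr ?ler0n // ler_wpDl // ler_pdivlMr // mul1r.
apply: (@le_trans _ _ (Num.truncn (eta * m%:R)).+1%:R); last by rewrite ler_nat.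
by rewrite ltW // truncnS_gt.
Qed.

(** The guarantee with [delta] = 1/8 demands success 7/8 for each [om], but the average over [om] is
    at most 1/2 + 1/4. *)
Lemma hiding_universal (f : R -> R) (g : nat -> nat) (eta : R) (v : seq X -> seq X) :
  0 < eta <= 1 -> f eta <= 64^-1 -> (1 < g 1)%N -> 4 <= (g 1)%:R * eta ->
  hiding B eta v -> universal_adversary f (@Cg R B g) (dirac_adv R v) eta.
Proof.
move=> /andP[e0 e1] fe g1 ge hv A msc lA H.
(* The successor keeps [eta * m] positive; [M] exceeds 2m as the separation requires. *)
pose m := (msc 64^-1 8^-1).+1; pose M := m.*2.+1; set K := g 1 in g1 ge.
have K0 : (0 < K)%N by lia.
have M0 : (0 < M)%N by [].
pose w := @weight R M (1 - 1%:R^-1) K%:R^-1 ((1%:R^-1 - K%:R^-1) / M%:R).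
have [w0 w1] : (forall o, 0 <= w o) /\ \sum_o w o = 1 by apply: weight_dist.
pose W (u : {ffun 'I_m -> outcome M}) := \prod_k w (u k).
pose good (u : {ffun 'I_m -> outcome M}) (om : {ffun 'I_M -> bool}) : bool :=
  dTV (A (msort (v (msort (sample B om u))))) (hard_dist K om) <= f eta + 64^-1.
have prob om : (7 / 8 <= \sum_u W u * (good u om)%:R)%R.
  have := fun C h1 h2 => H (hard_dist K om) C 64^-1 8^-1 h1 h2 m (leqnSn _).
  have -> : 1 - 8^-1 = 7 / 8 :> R by lra.
  have half01 (x : R) : 1 < x -> 0 < x^-1 < 1.
    by move=> x1; rewrite invr_gt0 invf_lt1 ?(lt_trans ltr01) ?x1.
  move=> /(_ (ex_intro _ _ (ex_intro _ 1%N (conj isT erefl)))).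
  move=> /(_ (half01 _ _) (half01 _ _)); rewrite !ltr1n => /(_ isT isT).
  rewrite /prob_adv.
  pose h s : R := (dTV (A (msort (v (msort s)))) (hard_dist K om) <= f eta + 64^-1)%R%:R.
  have pE : hard_dist K om = mixture w (pt (selector om) (index_of B (selection om)) 1).
    apply: pijk_mixture => //; first exact: B_uniq.
    exact: perm_selection.
  rewrite (_ : esum _ _ = \esum_(s in [set s : seq X | size s = m])
     (prodp (hard_dist K om) s * h s)%:E)%E.
    by rewrite pE esum_prodp // lee_fin.
  apply: eq_esum => s _.
  pose h' t : R := prodp (hard_dist K om) s * (dTV (A (msort t)) (hard_dist K om) <= f eta + 64^-1)%R%:R.
  have p0 : 0 <= prodp (hard_dist K om) s.
    by apply: prodr_ge0 => x _; case: (hard_dist_dist om K0).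
  (* The adversary is a point mass, so the sum over its outputs collapses to [v (msort s)]. *)
  have := @esum_mixture R _ unit (fun=> 1) (fun=> v (msort s)) h' (fun=> ler01).
  rewrite big_const card_unit /= addr0 mul1r => <-; last by move=> t; rewrite mulr_ge0.
  rewrite esum_mkcond; apply: eq_esum => t _; rewrite /h'.
  case: (boolP (_ <= _)) => dle; last by rewrite memNset ?mulr0 //; apply/negP.
  by rewrite mem_set // mulr1 mulrC.
(* The learner gives one answer for both. Two successes would put the distances at a total of at
   most 4/64, below 1/8. *)
have sep (u : {ffun 'I_m -> outcome M}) om : (n_tells u <= Num.truncn (eta * m%:R))%N ->
    ~~ (good u om && good u (reflect_off u om)).
  move=> ut; rewrite /good -(msort_eq (hv _ _ om _ M0 ut)).
  apply/negP => /andP[d1 d2].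
  have := @hard_dist_separated K M m u om _ (lA (msort (v (msort (sample B om u))))) g1 (ltnSn _).
  lra.
have m0 : 0 < m%:R :> R by rewrite ltr0n.
have em0 : 0 < eta * m%:R by rewrite mulr_gt0.
set N := #|{ffun 'I_M -> bool}|.
have N0 : 0 < N%:R :> R.
  by rewrite ltr0n /N; apply/card_gt0P; exists [ffun=> true].
have total : N%:R * (7 / 8) <= N%:R * (3 / 4) :> R.
  apply: (@le_trans _ _ (\sum_(om : {ffun 'I_M -> bool}) \sum_u W u * (good u om)%:R)).
    by rewrite mulr_natl -sumr_const; apply: ler_sum => om _.
  (* Now [u] is fixed and [om] varies, as the reflection argument needs. *)
  rewrite exchange_big /=.
  apply: (@le_trans _ _ (\sum_u W u * (N%:R * (2^-1 + (n_tells u)%:R / (eta * m%:R))))).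
    apply: ler_sum => u _; rewrite -mulr_sumr ler_wpM2l ?prodr_ge0 //.
    by apply: average_success => // ? ?; apply: sep.
  rewrite (_ : \sum_u _ = N%:R * (2^-1 * \sum_u W u +
       (\sum_u W u * \sum_k (u k == inl true)%:R) / (eta * m%:R))); last first.
    rewrite mulr_sumr mulr_suml -big_split mulr_sumr; apply: eq_bigr => u _ /=.
    rewrite /n_tells natr_sum; ring.
  rewrite /W sum_iid // expected_count // ler_wpM2l ?ler0n // mulr1 /=.
  (* The expected number of revealing points is m/K. *)
  have -> : m%:R * K%:R^-1 / (eta * m%:R) = (K%:R * eta)^-1.
    by field; rewrite !gt_eqF ?ltr0n.
  have : (K%:R * eta)^-1 <= 4^-1 by rewrite lef_pV2 ?posrE // mulr_gt0 // ltr0n.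
  lra.
move: total; rewrite ler_pM2l //; lra.
Qed.

End LowerBound.

(** * Choice of the budget and of [g] *)

Theorem theoremC4 (R : realType) (B : nat -> seq nat) (f : R -> R) :
  enumerates_finsets B ->
  {within [set x : R | 0 <= x <= 1], continuous f} ->
  {in `[0, 1] &, {homo f : x y / x <= y}} ->
  (forall x, x \in `[0, 1] -> f x \in `[0, 1]) ->
  f 0 = 0 ->
  exists g : nat -> nat,
    {homo g : a b / (a <= b)%N} /\
    (forall j, (0 < j)%N -> (j <= g j)%N) /\
    (* (i) *)
    realizable_learnable_with (@Cg R B g)
      (fun eps delta => ln (delta^-1) * (g `|Num.ceil (eps^-1)|%N)%:R) /\
    (* (ii) *)
    ~ add_robust_learnable f (@Cg R B g) /\
    (exists V eta, additive_adv V /\ has_budget V eta /\ 0 <= eta <= 1 /\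
        universal_adversary f (@Cg R B g) V eta) /\
    (* (iii) *)
    ~ sub_robust_learnable f (@Cg R B g) /\
    (exists V eta, subtractive_adv V /\ has_budget V eta /\ 0 <= eta <= 1 /\
        universal_adversary f (@Cg R B g) V eta).
Proof.
move=> Benum fcont _ _ f0.
have [eta eta01 feta] : exists2 eta : R, 0 < eta <= 1 & f eta <= 64^-1.
  have D0 : [set x : R | 0 <= x <= 1] 0 by rewrite /= lexx ler01.
  have /subspace_continuousP/(_ 0 D0)/cvgrPdist_le/(_ 64^-1) := fcont.
  rewrite invr_gt0 ltr0n => /(_ isT); rewrite near_withinE => /nbhs_ballP[e /= e0 H].
  (* Half the radius lies strictly inside the ball of continuity at 0; the minimum with 1 stays in
     the domain of [f]. *)
  exists (Num.min (e / 2) 1).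
    by rewrite lt_min divr_gt0 //= ltr01 ge_min lexx orbT.
  have eta0 : 0 < Num.min (e / 2) 1 by rewrite lt_min divr_gt0 //= ltr01.
  have := H (Num.min (e / 2) 1); rewrite /from_subspace f0 sub0r normrN => H'.
  apply: le_trans (ler_norm _) (H' _ _); last by rewrite /= ltW // ge_min lexx orbT.
  by rewrite /ball /= sub0r normrN gtr0_norm // gt_min; apply/orP; left; lra.
have /andP[e0 e1] := eta01.
pose K := (Num.truncn (4 / eta)).+1.
have Ke : 4 <= K%:R * eta by rewrite -ler_pdivrMr // ltW // truncnS_gt.
exists (fun j => j + K)%N.
have g1 : (1 < 1 + K)%N by [].
have ge : 4 <= (1 + K)%:R * eta by rewrite natrD mulrDl ler_wpDl // mul1r ltW.
have eta01' : 0 <= eta <= 1 by rewrite ltW.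
have [addA addb] := add_fakes_additive B eta01.
have [subA subb] := hide_tells_subtractive eta01.
have addU : universal_adversary f (@Cg R B (addn^~ K)) (dirac_adv R (add_fakes B eta)) eta.
  apply: hiding_universal => //; exact: add_fakes_hiding.
have subU : universal_adversary f (@Cg R B (addn^~ K)) (dirac_adv R (hide_tells eta)) eta.
  apply: hiding_universal => //; exact: hide_tells_hiding.
split; first by move=> a b ab; rewrite leq_add2r.
split; first by move=> j _; rewrite leq_addr.
split.
  apply: Cg_realizable => //; first by move=> a b ab; rewrite leq_add2r.
  by move=> j _; rewrite leq_addr.
split.
  by move=> [A [msc [lA H]]]; apply: (addU A msc lA); apply: H.
split; first by exists (dirac_adv R (add_fakes B eta)), eta.
split.
  by move=> [A [msc [lA H]]]; apply: (subU A msc lA); apply: H.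
by exists (dirac_adv R (hide_tells eta)), eta.
Qed.
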